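(* Suppose $p:\mathbb{R}\to(1,\infty)$ belongs to $SO$ and satisfies $1<\operatorname{ess\,inf}_{x\in\mathbb{R}}p(x)$ and $\operatorname{ess\,sup}_{x\in\mathbb{R}}p(x)<\infty$. Let $\{h_k\}_{k=1}^\infty\subset\mathbb{R}$ be a sequence tending to $+\infty$ (resp. to $-\infty$) and such that the limit $\lim_{k\to\infty}p(h_k)=:q$ exists. Suppose $w\in C(\mathbb{R})$ and $\{w_k\}_{k=1}^\infty\subset C(\mathbb{R})$ are such that (i) for all $x\in\mathbb{R}$, $\lim_{k\to\infty}w_k(x)=w(x)$, and this convergence is uniform on each closed segment $J\subset\mathbb{R}$; (ii) there exists a constant $C>0$ such that for all $k\in\mathbb{N}$ and $x\in\mathbb{R}$, $$|w(x)|\le\frac{C}{1+|x|},\qquad |w_k(x)|\le\frac{C}{1+|x|}.$$ Then $$\lim_{k\to\infty}\|V_{h_k}w_k\|_{p(\cdot)}=\|w\|_q.$$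
   Context: $C(\mathbb{R})$ is the set of continuous complex-valued functions on $\mathbb{R}$. For continuous $f:\mathbb{R}\to\mathbb{C}$ and $J\subset\mathbb{R}$ let $\operatorname{osc}(f,J):=\sup_{t,\tau\in J}|f(t)-f(\tau)|$. $SO$ is the set of all bounded continuous $f:\mathbb{R}\to\mathbb{C}$ with $\lim_{x\to+\infty}\operatorname{osc}(f,[-2x,-x]\cup[x,2x])=0$. For $h\in\mathbb{R}$, $V_h$ is the translation operator $(V_hf)(x):=f(x-h)$. For a measurable exponent $p$, $\|f\|_{p(\cdot)}:=\inf\{\lambda>0:\int_{\mathbb{R}}|f(x)/\lambda|^{p(x)}dx\le1\}$ is the norm of the variable Lebesgue space $L^{p(\cdot)}(\mathbb{R})$, and $\|\cdot\|_q$ is the norm of the standard Lebesgue space $L^q(\mathbb{R})$. *)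

(* Defs.v *)
From HB Require Import structures.
From mathcomp Require Import all_boot all_order all_algebra.
From mathcomp Require Import complex.
From mathcomp Require Import all_classical all_reals all_analysis.

Set Implicit Arguments.
Unset Strict Implicit.
Unset Printing Implicit Defensive.

Import Order.TTheory GRing.Theory Num.Theory.
Import numFieldNormedType.Exports.

Local Open Scope classical_set_scope.
Local Open Scope ring_scope.
Local Open Scope complex_scope.

(* R[i] is only a numClosedFieldType in mathcomp-real-closed; this gives it the
   topology, uniformity and norm that every numFieldType carries. *)
HB.instance Definition _ (R : rcfType) :=
  NormedModule.copy R[i] (R[i] : numFieldType)^o.

(* The norm `|z| of z : R[i] lives in R[i]; this is the real-valued modulus. *)
Definition modulus {R : rcfType} (z : R[i]) : R := Normc.normc z.

Definition osc {R : realType} (f : R -> R[i]) (J : set R) : \bar R :=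
  ereal_sup [set (modulus (f z.1 - f z.2))%:E | z in J `*` J].

Definition SO {R : realType} : set (R -> R[i]) :=
  [set f | [/\ continuous f,
               exists M : R, forall x, modulus (f x) <= M &
               osc f (`[- (2 * x), - x] `|` `[x, 2 * x]) @[x --> +oo]
                 --> 0%E]].

Definition translation {R : realType} (h : R) (f : R -> R[i]) : R -> R[i] :=
  fun x => f (x - h).

(* The value is +oo when no lambda is admissible. *)
Definition varLnorm {R : realType} (p : R -> R) (f : R -> R[i]) : \bar R :=
  ereal_inf [set lambda%:E | lambda in [set lambda : R | 0 < lambda /\
    (\int[lebesgue_measure]_x (modulus (f x / lambda%:C) `^ p x)%:E <= 1)%E]].

(* Main.v *)
Require Import Defs.
From mathcomp Require Import all_boot all_order all_algebra.
From mathcomp Require Import complex.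
From mathcomp Require Import all_classical all_reals all_analysis.
From mathcomp Require Import ess_sup_inf measurable_realfun ring lra.

Set Implicit Arguments.
Unset Strict Implicit.
Unset Printing Implicit Defensive.

Import Order.TTheory GRing.Theory Num.Theory.
Import numFieldNormedType.Exports.

Local Open Scope classical_set_scope.
Local Open Scope ring_scope.
Local Open Scope complex_scope.

(** The norm varLnorm p f is the infimum of the [t > 0] for which the modular
    [F(t)], the integral of [(|f| / t) ^ p], is at most 1.  Substituting
    [x = y + h_k], the modular of the translated function [V_(h_k) w_k] is the
    integral of [(|w_k(y)| / t) ^ p(y + h_k)].  For fixed [y] and [k] large,
    [h_k] and [y + h_k] lie in one and the same shell [x <= |z| <= 2x] with [x]
    tending to infinity, so slow oscillation forces [p(y + h_k)] to the same
    limit [q] as [p(h_k)] (SO_cvg_shift).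

    The essential lower bound [c > 1] of [p] is a true lower bound because [p]
    is continuous (ess_inf_le_continuous).  Together with the decay
    [C / (1 + |y|)] of the [w_k] and with the boundedness of [p] this dominates
    all the integrands by a multiple of [(1 + |y|) ^ (- c)], which is
    integrable (powR_decay_le, integrable_decay).  By dominated convergence the
    modulars [F_k(t)] tend, for each [t > 0], to the modular of [w] with
    constant exponent [q] (modular_cvg), that is to [(N / t) ^ q] where [N] is
    the [L^q] norm of [w].

    This limit is below 1 for [t > N] and above 1 for [0 < t < N], and every
    [F_k] is nonincreasing in [t]; hence the thresholds at which the [F_k] pass
    the level 1, which are the norms in question, tend to [N]
    (cvg_ereal_inf_sublevel). *)

(** * The modulus as a real-valued norm *)

Lemma modulus_ge0 {R : realType} (z : R[i]) : 0 <= modulus z.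
Proof. by case: z => a b; rewrite /modulus /= sqrtr_ge0. Qed.

Lemma normr_modulus {R : realType} (z : R[i]) : `|z| = (modulus z)%:C.
Proof. by []. Qed.

Lemma modulus_real {R : realType} (x : R) : modulus x%:C = `|x|.
Proof. by rewrite /modulus /= expr0n /= addr0 sqrtr_sqr. Qed.

Lemma modulus_div {R : realType} (z : R[i]) (a : R) : 0 < a ->
  modulus (z / a%:C) = modulus z / a.
Proof.
move=> a0; rewrite /modulus Normc.normcM Normc.normcV.
by rewrite -[Normc.normc a%:C]/(modulus a%:C) modulus_real gtr0_norm.
Qed.

Lemma ler_modulusB {R : realType} (z w : R[i]) :
  `|modulus z - modulus w| <= modulus (z - w).
Proof.
have zw (u v : R[i]) : modulus u - modulus v <= modulus (u - v).
  by rewrite -lecR rmorphB /= -!normr_modulus lerB_dist.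
have modN (u : R[i]) : modulus (- u) = modulus u.
  by have /(congr1 (@complex.Re R)) := normrN u.
rewrite ler_norml zw andbT lerNl opprB.
by rewrite -(modN (z - w)) opprB zw.
Qed.

Lemma cvg_modulus {R : realType} {T : Type} (F : set_system T) {FF : Filter F}
  (f : T -> R[i]) (l : R[i]) :
  f x @[x --> F] --> l -> modulus (f x) @[x --> F] --> modulus l.
Proof.
move=> fl; apply/cvgrPdist_lt => e e0.
have e0C : 0 < e%:C :> R[i] by rewrite ltcR.
move/cvgrPdist_lt: fl => /(_ _ e0C); apply: filterS => x.
rewrite normr_modulus ltcR; apply: le_lt_trans; exact: ler_modulusB.
Qed.

(** * Powers with a varying exponent *)

(** Away from [a = 0] this is the continuity of [exp (b * ln a)].  At [a = 0] it
    is the positivity of the limit exponent that makes the power small: once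
    [g > b / 2] and [f < 1], it is at most [f ^ (b / 2)]. *)
Lemma cvg_powR {R : realType} {T : Type} (F : set_system T) {FF : Filter F}
    (f g : T -> R) (a b : R) : 0 <= a -> 0 < b -> (forall x, 0 <= f x) ->
  f x @[x --> F] --> a -> g x @[x --> F] --> b ->
  f x `^ g x @[x --> F] --> a `^ b.
Proof.
rewrite le_eqVlt => /predU1P[<-|a_gt0] b0 f0 fa gb; last first.
  have -> : a `^ b = expR (b * ln a) by rewrite /powR gt_eqF.
  apply: (@cvg_trans _ (expR (g x * ln (f x)) @[x --> F])).
    apply: near_eq_cvg; near=> x.
    rewrite /powR gt_eqF//; near: x; exact: cvgr_gt fa _ a_gt0.
  apply: (@continuous_cvg _ _ _ _ _ _ expR); first exact: continuous_expR.
  apply: cvgM => //; apply: (@continuous_cvg _ _ _ _ _ _ (@ln R)) => //.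
  exact: continuous_ln.
rewrite powR0 ?gt_eqF//; apply/cvgr0Pnorm_lt => e e0.
have b2 : 0 < b / 2 by rewrite divr_gt0.
near=> x.
have fx1 : f x < 1 by near: x; exact: cvgr_lt fa _ ltr01.
(* This makes `f x ^ (b / 2) < e`. *)
have fxe : f x < e `^ (b / 2)^-1.
  by near: x; apply: cvgr_lt fa _ _; exact: powR_gt0.
have gx : b / 2 < g x.
  by near: x; apply: cvgr_gt gb _ _; rewrite ltr_pdivrMr// ltr_pMr// ltr1n.
rewrite ger0_norm ?powR_ge0// (@le_lt_trans _ _ (f x `^ (b / 2)))//.
  have [->|fx0] := eqVneq (f x) 0.
    by rewrite !powR0 ?gt_eqF// (lt_trans b2).
  by rewrite ger_powR ?ltW// lt0r fx0 f0.
have -> : e = (e `^ (b / 2)^-1) `^ (b / 2).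
  by rewrite -powRrM mulVf ?gt_eqF// powRr1 // ltW.
by rewrite gt0_ltr_powR// nnegrE ?powR_ge0.
Unshelve. all: by end_near. Qed.

(** * Strict inequalities with a limit *)

Lemma near_lt_ereal {R : realType} {T : Type} (F : set_system T)
    {FF : Filter F} (u : T -> \bar R) (l b : \bar R) :
  u x @[x --> F] --> l -> (l < b)%E -> \forall x \near F, (u x < b)%E.
Proof.
move=> ul lb.
have : nbhs l [set z : \bar R | (z < b)%E].
  by apply: open_nbhs_nbhs; split; first exact: open_ereal_lt_ereal.
exact: ul.
Qed.

Lemma near_gt_ereal {R : realType} {T : Type} (F : set_system T)
    {FF : Filter F} (u : T -> \bar R) (l b : \bar R) :
  u x @[x --> F] --> l -> (b < l)%E -> \forall x \near F, (b < u x)%E.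
Proof.
move=> ul lb.
have : nbhs l [set z : \bar R | (b < z)%E].
  by apply: open_nbhs_nbhs; split; first exact: open_ereal_gt_ereal.
exact: ul.
Qed.

(** * Essential bounds, translations, slow oscillation *)

(** The set where a continuous function lies strictly below a given level is
    open, so it cannot be negligible unless it is empty. *)
Lemma ess_inf_le_continuous {R : realType} (p : R -> R) : continuous p ->
  forall x, (ess_inf lebesgue_measure (EFin \o p) <= (p x)%:E)%E.
Proof.
move=> cp x; rewrite leNgt; apply/negP => px.
set m := ess_inf _ _ in px.
have : nbhs x [set y | ((p y)%:E < m)%E].
  case: m px => [r| |]//.
    by rewrite lte_fin => pxr; apply: cvgr_lt (cp x) _ pxr.
  by move=> _; near=> y; rewrite /= ltry.
move=> /nbhs_ballP[e /= e0 be].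
have [N [mN N0 sN]] := ess_inf_le lebesgue_measure (EFin \o p).
have bN : ball x e `<=` N.
  apply: (subset_trans _ sN) => y /be /= ym.
  by apply/negP; rewrite -ltNge.
have : (lebesgue_measure (ball x e) <= 0)%E.
  by rewrite -N0; apply: le_measure; rewrite ?inE//; exact: measurable_ball.
by rewrite (lebesgue_measure_ball _ (ltW e0)) leNgt lte_fin mulrn_wgt0.
Unshelve. all: by end_near. Qed.

Lemma integral_translation {R : realType} (g : R -> R) (a : R) :
  continuous g -> (forall x, 0 <= g x) ->
  (\int[lebesgue_measure]_x (g x)%:E =
   \int[lebesgue_measure]_x (g (x + a)%R)%:E)%E.
Proof.
move=> cg g0.
pose F (x : R) := x + a.
have dF (x : R) : is_derive x 1 F 1.
  have := @is_deriveD R R R id (cst a) x 1 1 0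
      (is_derive_id _ _) (is_derive_cst _ _ _).
  by rewrite addr0.
have F1 : F^`()%classic = cst 1.
  apply/funext => x; rewrite derive1E; exact: derive_val.
rewrite (@increasing_ge0_integration_by_substitutionT _ F g)//.
- by apply: eq_integral => x _; rewrite F1 /= mulr1.
- by move=> x y xy; rewrite /F ltrD2r.
- by rewrite F1; exact: cst_continuous.
- by rewrite F1; exact: is_cvg_cst.
- by rewrite F1; exact: is_cvg_cst.
- apply/cvgrNyPle => A; near=> x; rewrite /F -lerBrDr; near: x.
  by apply: nbhs_ninfty_le; exact: num_real.
- apply/cvgryPge => A; near=> x; rewrite /F -lerBlDr; near: x.
  by apply: nbhs_pinfty_ge; exact: num_real.
Unshelve. all: by end_near. Qed.

(** Once [|h k|] is large compared with [|y|], the points [h k] and [y + h k]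
    lie in a common shell [x <= |z| <= 2x], and the oscillation of [p] over such
    shells vanishes at infinity. *)
Lemma SO_cvg_shift {R : realType} (p : R -> R) (h : nat -> R) (q : R) :
  SO (fun x => (p x)%:C) -> `|h k| @[k --> \oo] --> +oo ->
  p (h k) @[k --> \oo] --> q ->
  forall y, p (y + h k) @[k --> \oo] --> q.
Proof.
move=> [_ _ osc0] hy phq y.
rewrite -[q]addr0.
have -> : (fun k => p (y + h k)) =
    (fun k => p (h k) + (p (y + h k) - p (h k))).
  by apply/funext => k; rewrite subrKC.
apply: cvgD => //; apply/cvgr0Pnorm_lt => e e0.
pose shell (x : R) : set R := `[- (2 * x), - x] `|` `[x, 2 * x].
have osce : \forall x \near +oo,
    (osc (fun x => (p x)%:C) (shell x) < e%:E)%E.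
  by apply: near_lt_ereal osc0 _; rewrite lte_fin.
have h23 : 2 / 3 * `|h k| @[k --> \oo] --> +oo.
  apply/cvgryPge => A; near=> k.
  rewrite mulrC -ler_pdivrMr//; near: k.
  by move/cvgryPge : hy; exact.
(* With `x = 2/3 |h k|` one has `|h k| = 3/2 x`, the middle of `[x, 2x]`, which
   leaves room for any shift `y` of size at most `x / 2 = |h k| / 3`. *)
have in_shell (x z : R) : x <= `|z| -> `|z| <= 2 * x -> shell x z.
  have [z0|z0] := leP 0 z.
    by rewrite ger0_norm// => xz zx; right; rewrite /= in_itv/= xz.
  rewrite ltr0_norm// => xz zx; left; rewrite /= in_itv/=.
  by rewrite lerNl zx lerNr.
near=> k.
have : (osc (fun x => (p x)%:C) (shell (2 / 3 * `|h k|)%R) < e%:E)%E.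
  by near: k; exact: h23 osce.
have yh : 3 * `|y| <= `|h k|.
  near: k; move/cvgryPge : hy; exact.
rewrite -lte_fin; apply: le_lt_trans.
apply: ereal_sup_ubound; exists (y + h k, h k).
  have tri1 : `|y + h k| <= `|y| + `|h k| by exact: ler_normD.
  have tri2 : `|h k| <= `|y + h k| + `|y|.
    by have := ler_normB (y + h k) y; rewrite addrAC subrr add0r.
  have y0 := normr_ge0 y.
  by split; apply: in_shell; lra.
by rewrite -modulus_real rmorphB.
Unshelve. all: by end_near. Qed.

(** * Convergence of the modulars *)

(** By symmetry it suffices to integrate over the positive half-line, where
    [(1 + x) ^ (1 - s) / (1 - s)] is an antiderivative vanishing at infinity. *)
Lemma integrable_decay {R : realType} (s : R) : 1 < s ->
  lebesgue_measure.-integrable [set: R]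
    (EFin \o fun x : R => (1 + `|x|) `^ (- s)).
Proof.
move=> s1.
pose f (x : R) := (1 + `|x|) `^ (- s).
have s1p : 0 < s - 1 by rewrite subr_gt0.
have pos (x : R) : 0 < 1 + `|x| by rewrite ltr_pwDl.
have cf : continuous f.
  move=> x; rewrite /f.
  have -> : (fun x : R => (1 + `|x|) `^ (- s)) =
            (fun x : R => expR (- s * ln (1 + `|x|))).
    by apply/funext => y; rewrite /powR gt_eqF.
  apply: (@continuous_cvg _ _ _ _ _ _ expR); first exact: continuous_expR.
  apply: cvgMl_tmp; apply: (@continuous_cvg _ _ _ _ _ _ (@ln R)).
    exact: continuous_ln.
  by apply: cvgD; [exact: cvg_cst|exact: norm_continuous].
apply/integrableP; split.
  by apply/measurable_EFinP; exact: continuous_measurable_fun.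
under eq_integral do rewrite /= ger0_norm ?powR_ge0//.
rewrite (@ge0_symfun_integralT _ f)//; last 2 first.
- by move=> x; exact: powR_ge0.
- by move=> x; rewrite /f /= normrN.
rewrite -set_itvcy.
pose G (x : R) := (1 - s)^-1 * expR ((1 - s) * ln (1 + x)).
have dG (x : R) : -1 < x -> is_derive x 1 G ((1 + x) `^ (- s)).
  move=> x1; have x1p : 0 < 1 + x by rewrite -ltrBlDl sub0r.
  have dl : is_derive (1 + x) 1 (@ln R) (1 + x)^-1 by exact: is_derive1_ln.
  have dD : is_derive x 1 (fun y : R => 1 + y) 1.
    have := @is_deriveD R R R (cst 1) id x 1 0 1
      (is_derive_cst _ _ _) (is_derive_id _ _).
    by rewrite add0r.
  have dlD := is_derive1_comp dl dD.
  have dc : is_derive x 1 (fun y : R => (1 - s) * ln (1 + y))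
      ((1 - s) * ((1 + x)^-1 * 1)) by exact: is_deriveZ.
  have de := is_derive1_comp (is_derive_expR _) dc.
  have dE : is_derive x 1 G _ := is_deriveZ (1 - s)^-1 de.
  apply: is_derive_eq dE _.
  have -> : (1 + x) `^ (- s) = expR (- s * ln (1 + x)).
    by rewrite /powR gt_eqF.
  have -> : (1 - s) * ln (1 + x) = ln (1 + x) + - s * ln (1 + x).
    by rewrite mulrDl mul1r.
  rewrite expRD lnK// /GRing.scale /=.
  have s1' : 1 - s != 0 by rewrite lt_eqF// subr_lt0.
  by field; rewrite s1' gt_eqF.
rewrite (@ge0_continuous_FTC2y _ f G 0 0).
- by rewrite sub0e lte_mul_pinfty// ltry.
- by move=> x _; exact: powR_ge0.
- exact: continuous_subspaceT.
- rewrite /G -[X in _ --> X](mulr0 (1 - s)^-1); apply: cvgMl_tmp.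
  apply/cvgr0Pnorm_lt => e e0; near=> x.
  have x1p : 0 < 1 + x by rewrite ltr_pwDl.
  rewrite ger0_norm ?expR_ge0// -[ltRHS]lnK// ltr_expR -ltr_ndivrMl ?subr_lt0//.
  rewrite -ltr_expR lnK// ltr_wpDl//.
- by move=> x x0; have [] // := dG x; rewrite (lt_trans _ x0)// ltrN10.
- apply: cvg_at_right_filter; apply: differentiable_continuous.
  apply/derivable1_diffP.
  by have [] // := dG 0; rewrite ltrN10.
- move=> x; rewrite in_itv/= andbT => x0; rewrite derive1E /f gtr0_norm//.
  by apply: derive_val; apply: dG; rewrite (lt_trans _ x0)// ltrN10.
Unshelve. all: by end_near. Qed.

(** Splitting [A / (1 + |y|)] into a factor [1 + A >= 1], whose powers grow with
    the exponent, and a factor [1 / (1 + |y|) <= 1], whose powers decrease,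
    gives a bound uniform over all exponents between [c] and [M]. *)
Lemma powR_decay_le {R : realType} (A c M a b y : R) :
  0 <= A -> 0 <= c -> c <= b <= M -> 0 <= a <= A / (1 + `|y|) ->
  a `^ b <= (1 + A) `^ M * (1 + `|y|) `^ (- c).
Proof.
move=> A0 c0 /andP[cb bM] /andP[a0 aA].
have y1 : 0 < 1 + `|y| by rewrite ltr_pwDl.
have u01 : 0 < (1 + `|y|)^-1 <= 1.
  by rewrite invr_gt0 y1 /= invf_le1// lerDl normr_ge0.
have b0 := le_trans c0 cb.
have A1 : 1 <= 1 + A by rewrite lerDl.
have A10 := le_trans ler01 A1.
apply: (@le_trans _ _ (((1 + A) / (1 + `|y|)) `^ b)).
  apply: ge0_ler_powR => //; rewrite ?nnegrE ?divr_ge0// ?(ltW y1)//.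
  by rewrite (le_trans aA)// ler_pM2r ?invr_gt0// lerDr.
rewrite powRM// ?invr_ge0 ?(ltW y1)//.
have -> : (1 + `|y|) `^ (- c) = (1 + `|y|)^-1 `^ c.
  by rewrite -powR_inv1 ?(ltW y1)// -powRrM mulN1r.
by apply: ler_pM; [exact: powR_ge0|exact: powR_ge0|exact: ler_powR|
                   exact: ger_powR].
Qed.

(** Although the exponent varies with [k], the bound of powR_decay_le does not,
    and it is integrable because [c > 1]; so dominated convergence applies. *)
Lemma modular_cvg {R : realType} (pk : nat -> R -> R) (vk : nat -> R -> R)
    (v : R -> R) (q c M A : R) :
  1 < c -> 0 <= A ->
  (forall k, continuous (pk k)) -> (forall k, continuous (vk k)) ->
  continuous v ->
  (forall k y, c <= pk k y <= M) ->
  (forall k y, 0 <= vk k y <= A / (1 + `|y|)) -> (forall y, 0 <= v y) ->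
  0 < q ->
  (forall y, pk k y @[k --> \oo] --> q) ->
  (forall y, vk k y @[k --> \oo] --> v y) ->
  lebesgue_measure.-integrable [set: R] (EFin \o fun y => v y `^ q) /\
  (\int[lebesgue_measure]_y (vk k y `^ pk k y)%:E)%E @[k --> \oo] -->
  (\int[lebesgue_measure]_y (v y `^ q)%:E)%E.
Proof.
move=> c1 A0 pkc vkc vc pkb vkb v0 q0 pkq vkv.
pose B : R := (1 + A) `^ M.
have mpow (g r : R -> R) : continuous g -> continuous r ->
    (forall x, 0 <= g x) -> (forall x, 0 < r x) ->
    measurable_fun [set: R] (fun y => (g y `^ r y)%:E).
  move=> cg cr g0 r0; apply/measurable_EFinP.
  apply: continuous_measurable_fun => x.
  apply: cvg_powR => //; [exact: cg|exact: cr].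
have pk0 k y : 0 < pk k y.
  by have /andP[+ _] := pkb k y; apply: lt_le_trans; rewrite (lt_trans _ c1).
have vk0 k y : 0 <= vk k y by have /andP[] := vkb k y.
have [|||||int_v _ cvg_v] := @dominated_convergence _ _ R lebesgue_measure
    [set: R] measurableT (fun k y => (vk k y `^ pk k y)%:E)
    (fun y => (v y `^ q)%:E)
    (fun y => (B%:E * (EFin \o (fun x : R => ((1 + `|x|) `^ (- c))%R)) y)%E).
- by move=> k; exact: mpow.
- by apply: mpow => //; exact: cst_continuous.
- apply: aeW => y _; apply: cvg_EFin; first exact: nearW.
  by apply: cvg_powR.
- by apply: integrableZl => //; exact: integrable_decay.
- apply: aeW => y k _; rewrite /= -EFinM lee_fin ger0_norm ?powR_ge0//.
  by apply: powR_decay_le => //; rewrite (le_trans ler01)// ltW.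
by split.
Qed.

(** * From modulars to norms *)

(** By monotonicity the sublevel set of each [F k] is an up-set of the positive
    half-line: a point [t] in it bounds the infimum from above, and a point
    outside it bounds the infimum from below.  The points [N + e] and [N - e]
    therefore trap the infimum. *)
Lemma cvg_ereal_inf_sublevel {R : realType} (F : nat -> R -> \bar R) (N : R) :
  0 <= N ->
  (forall k s t, 0 < s -> s <= t -> (F k t <= F k s)%E) ->
  (forall t, N < t -> \forall k \near \oo, (F k t <= 1)%E) ->
  (forall t, 0 < t < N -> \forall k \near \oo, (1 < F k t)%E) ->
  ereal_inf [set t%:E | t in [set t | 0 < t /\ (F k t <= 1)%E]]
    @[k --> \oo] --> N%:E.
Proof.
move=> N0 Fmono above below.
set I := fun k => ereal_inf _.
have bounds (e : R) : 0 < e ->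
    \forall k \near \oo, ((N - e)%:E <= I k <= (N + e)%:E)%E.
  move=> e0; have Ne : N < N + e by rewrite ltrDl.
  have up := above _ Ne.
  have low : \forall k \near \oo, ((N - e)%:E <= I k)%E.
    have [Ne0|Ne0] := leP (N - e) 0.
      near=> k; apply: le_ereal_inf_tmp => _ [t [t0 _] <-].
      by rewrite lee_fin (le_trans Ne0)// ltW.
    have NeN : 0 < N - e < N by rewrite Ne0 ltrBlDr.
    apply: filterS (below _ NeN) => k Fk.
    apply: le_ereal_inf_tmp => _ [t [t0 Ft] <-].
    rewrite lee_fin leNgt; apply/negP => tNe.
    have := le_trans (Fmono k _ _ t0 (ltW tNe)) Ft.
    by rewrite leNgt Fk.
  near=> k; apply/andP; split; first by near: k.
  apply: ereal_inf_lbound; exists (N + e) => //=; split.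
    by rewrite ltr_wpDl.
  by near: k.
apply/fine_cvgP; split.
  apply: filterS (bounds 1 ltr01) => k /andP[lo hi].
  by rewrite fin_real// (lt_le_trans _ lo) ?ltNyr// (le_lt_trans hi)// ltry.
apply/cvgrPdist_le => e e0; apply: filterS (bounds e e0) => k /=.
move=> /andP[lo hi].
have fI : I k \is a fin_num.
  by rewrite fin_real// (lt_le_trans _ lo) ?ltNyr// (le_lt_trans hi)// ltry.
move: lo hi; rewrite -(fineK fI) !lee_fin /= => lo hi.
by rewrite distrC ler_distl lo.
Unshelve. all: by end_near. Qed.

Theorem lemma4p2 (R : realType) (p : R -> R)
    (p_gt1 : forall x, 1 < p x)
    (p_SO : SO (fun x => (p x)%:C))
    (p_inf : (1 < ess_inf lebesgue_measure (EFin \o p))%E)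
    (p_sup : (ess_sup lebesgue_measure (EFin \o p) < +oo)%E)
    (h : nat -> R) (h_infty : (h @ \oo --> +oo) \/ (h @ \oo --> -oo))
    (q : R) (p_h : p (h k) @[k --> \oo] --> q)
    (w : R -> R[i]) (w_ : nat -> R -> R[i])
    (w_cont : continuous w) (w_k_cont : forall k, continuous (w_ k))
    (w_cvg : forall x, w_ k x @[k --> \oo] --> w x)
    (w_unif : forall a b : R, {uniform `[a, b], w_ @ \oo --> w})
    (w_bound : exists2 C : R, 0 < C &
       (forall x, modulus (w x) <= C / (1 + `|x|)) /\
       (forall k x, modulus (w_ k x) <= C / (1 + `|x|))) :
  varLnorm p (translation (h k) (w_ k)) @[k --> \oo]
    --> Lnorm lebesgue_measure q%:E (fun x => (modulus (w x))%:E).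
Proof.
have [C C0 [wC wkC]] := w_bound.
have p0 x : 0 < p x by rewrite (lt_trans ltr01).
(* Since `p` is positive it is the modulus of its complex-valued version. *)
have p_cont : continuous p.
  have [cp _ _] := p_SO; move=> x.
  have pE : p = (fun y => modulus (p y)%:C).
    by apply/funext => y; rewrite modulus_real gtr0_norm.
  by rewrite pE; apply: cvg_modulus; exact: cp.
have [M pM] : exists M, forall x, p x <= M.
  have [_ [M pM] _] := p_SO; exists M => x.
  by rewrite -[p x]gtr0_norm// -modulus_real.
have [c c1 cp] : exists2 c, 1 < c & forall x, c <= p x.
  have inf_le := ess_inf_le_continuous p_cont.
  have inf_fin : ess_inf lebesgue_measure (EFin \o p) \is a fin_num.
    rewrite fin_real// (lt_trans _ p_inf) ?ltNyr//=.
    by rewrite (le_lt_trans (inf_le 0))// ltry.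
  exists (fine (ess_inf lebesgue_measure (EFin \o p))).
    by rewrite -lte_fin fineK.
  by move=> x; rewrite -lee_fin fineK.
have cq : c <= q.
  by apply: (cvgr_to_ge p_h); apply: nearW => k; exact: cp.
have q0 : 0 < q by rewrite (lt_le_trans _ cq)// (lt_trans _ c1).
have h_abs : `|h k| @[k --> \oo] --> +oo.
  apply/cvgryPge => A; case: h_infty => [/cvgryPge/(_ A)|/cvgrNyPle/(_ (- A))].
    by apply: filterS => k /le_trans; apply; exact: ler_norm.
  apply: filterS => k; rewrite lerNr => /le_trans; apply.
  by rewrite -normrN ler_norm.
have p_shift := SO_cvg_shift p_SO h_abs p_h.
have mw_cont : continuous (fun x => modulus (w x)).
  by move=> x; apply: cvg_modulus; exact: w_cont.
have mwk_cont k : continuous (fun x => modulus (w_ k x)).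
  by move=> x; apply: cvg_modulus; exact: w_k_cont.
have shift_cont (a : R) : continuous (fun x : R => x + a).
  by move=> x; apply: cvgD; [exact: cvg_id|exact: cvg_cst].
pose F k (t : R) :=
  (\int[lebesgue_measure]_x
     (modulus (translation (h k) (w_ k) x / t%:C) `^ p x)%:E)%E.
have cont_modular k (t : R) : 0 < t ->
    continuous (fun x => modulus (translation (h k) (w_ k) x / t%:C) `^ p x).
  move=> t0 x; apply: cvg_powR; rewrite ?modulus_ge0//.
  - by move=> y; exact: modulus_ge0.
  - under eq_fun do rewrite modulus_div//; rewrite modulus_div//.
    apply: cvgMr_tmp.
    apply: (@continuous_comp _ _ _ (fun y => y - h k)
              (fun y => modulus (w_ k y))); last exact: mwk_cont.
    exact: shift_cont.
  - exact: p_cont.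
have modularE k (t : R) : 0 < t ->
    F k t = (\int[lebesgue_measure]_y
               ((modulus (w_ k y) / t) `^ p (y + h k))%:E)%E.
  move=> t0; rewrite /F (integral_translation (h k) (cont_modular k t t0)).
  - apply: eq_integral => y _.
    by rewrite /translation addrK modulus_div.
  - by move=> x; exact: powR_ge0.
have divC (z : R[i]) (t y : R) : 0 < t -> modulus z <= C / (1 + `|y|) ->
    0 <= modulus z / t <= C / t / (1 + `|y|).
  move=> t0 zC; rewrite divr_ge0 ?modulus_ge0 ?(ltW t0)//=.
  by rewrite mulrAC ler_pM2r ?invr_gt0.
have modular_lim (t : R) : 0 < t ->
    lebesgue_measure.-integrable [set: R]
      (EFin \o fun y => (modulus (w y) / t) `^ q) /\
    F k t @[k --> \oo] -->
    (\int[lebesgue_measure]_y ((modulus (w y) / t) `^ q)%:E)%E.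
  move=> t0; under eq_cvg do rewrite modularE//.
  apply: (@modular_cvg _ (fun k y => p (y + h k))
            (fun k y => modulus (w_ k y) / t) _ q c M (C / t)) => //.
  - by rewrite divr_ge0// ltW.
  - move=> k x.
    apply: (@continuous_comp _ _ _ (fun y => y + h k) p); last exact: p_cont.
    exact: shift_cont.
  - by move=> k x; apply: cvgMr_tmp; exact: mwk_cont.
  - by move=> x; apply: cvgMr_tmp; exact: mw_cont.
  - by move=> k y; rewrite cp pM.
  - by move=> k y; apply: divC.
  - by move=> y; rewrite divr_ge0 ?modulus_ge0 ?ltW.
  - by move=> y; apply: cvgMr_tmp; apply: cvg_modulus; exact: w_cvg.
have int_wq : lebesgue_measure.-integrable [set: R]
    (EFin \o fun y => modulus (w y) `^ q).
  have [+ _] := modular_lim 1 ltr01.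
  by under eq_fun do rewrite divr1.
pose I : R := fine (\int[lebesgue_measure]_y (modulus (w y) `^ q)%:E).
have IE : (\int[lebesgue_measure]_y (modulus (w y) `^ q)%:E = I%:E)%E.
  by rewrite fineK//; exact: integrable_fin_num int_wq.
have I0 : 0 <= I.
  by rewrite fine_ge0// integral_ge0// => y _; rewrite lee_fin powR_ge0.
pose N : R := I `^ q^-1.
have NE : Lnorm lebesgue_measure q%:E (fun x => (modulus (w x))%:E) = N%:E.
  rewrite unlock /=.
  have -> : (\int[lebesgue_measure]_x poweR `|(modulus (w x))%:E| q = I%:E)%E.
    rewrite -IE; apply: eq_integral => x _.
    by rewrite abse_EFin poweR_EFin ger0_norm ?modulus_ge0.
  by rewrite poweR_EFin.
have NqE : N `^ q = I by rewrite /N -powRrM mulVf ?gt_eqF// powRr1.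
have limE (t : R) : 0 < t ->
    (\int[lebesgue_measure]_y ((modulus (w y) / t) `^ q)%:E =
     (I / t `^ q)%:E)%E.
  move=> t0; rewrite mulrC EFinM -IE -ge0_integralZl//.
  - apply: eq_integral => y _; rewrite -EFinM; congr EFin.
    rewrite powRM ?modulus_ge0 ?invr_ge0 ?(ltW t0)//.
    by rewrite -(powR_inv1 (ltW t0)) -powRrM mulN1r powRN mulrC.
  - by case/integrableP: int_wq.
  - by move=> y _; rewrite lee_fin powR_ge0.
  - by rewrite lee_fin invr_ge0 powR_ge0.
have normE : (fun k => varLnorm p (translation (h k) (w_ k))) =
    (fun k => ereal_inf [set t%:E | t in [set t | 0 < t /\ (F k t <= 1)%E]]).
  by apply/funext.
have F_mono k (s t : R) : 0 < s -> s <= t -> (F k t <= F k s)%E.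
  move=> s0 st; have t0 := lt_le_trans s0 st.
  apply: ge0_le_integral => //.
  + by move=> x _; rewrite lee_fin powR_ge0.
  + apply/measurable_EFinP; apply: continuous_measurable_fun.
    exact: cont_modular.
  + apply/measurable_EFinP; apply: continuous_measurable_fun.
    exact: cont_modular.
  + move=> x _; rewrite lee_fin !modulus_div// ge0_ler_powR ?nnegrE//.
    * exact: ltW.
    * by rewrite divr_ge0 ?modulus_ge0 ?ltW.
    * by rewrite divr_ge0 ?modulus_ge0 ?ltW.
    * by rewrite ler_wpM2l ?modulus_ge0// lef_pV2.
have F_above (t : R) : N < t -> \forall k \near \oo, (F k t <= 1)%E.
  move=> Nt; have t0 : 0 < t by rewrite (le_lt_trans _ Nt)// powR_ge0.
  have [_ Ft] := modular_lim t t0; rewrite limE// in Ft.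
  (* `I = N ^ q`, so comparing `I / t ^ q` with 1 is comparing `N` with `t`. *)
  have It : I / t `^ q < 1.
    rewrite ltr_pdivrMr ?powR_gt0// mul1r -NqE.
    by rewrite gt0_ltr_powR// nnegrE ?powR_ge0 ?ltW.
  have lt1 : \forall k \near \oo, (F k t < 1)%E.
    by apply: near_lt_ereal Ft _; rewrite lte_fin.
  by apply: filterS lt1 => k /ltW.
have F_below (t : R) : 0 < t < N -> \forall k \near \oo, (1 < F k t)%E.
  move=> /andP[t0 tN].
  have [_ Ft] := modular_lim t t0; rewrite limE// in Ft.
  have It : 1 < I / t `^ q.
    rewrite ltr_pdivlMr ?powR_gt0// mul1r -NqE.
    by rewrite gt0_ltr_powR// nnegrE ?powR_ge0 ?ltW.
  by apply: near_gt_ereal Ft _; rewrite lte_fin.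
rewrite NE normE.
exact: cvg_ereal_inf_sublevel (powR_ge0 _ _) F_mono F_above F_below.
Qed.
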